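(* Let $0\le h\le n$. (1) If $h+1\le b\le n$ and $b+c=n$, then $D_{n,h}(0,b,c)=\dfrac{\prod_{l=h+1}^{b}(1-(-q)^l)}{1-(-q)^{b-h}}$. (2) If $h-1\le b\le n$ and $b+c=n-1$, then $D_{n,h}(1,b,c)=1$ if $b\in\{h-1,h\}$, and $D_{n,h}(1,b,c)=\prod_{l=h+1}^{b}(1-(-q)^l)$ if $b\ge h+1$.
   Context: $q$ is a power of an odd prime; $b,c\ge0$ are integers. Put $P(k)=\prod_{l=1}^{k}(1-(-q)^{-l})$ (empty products $=1$, empty sums $=0$). For nonnegative integers $a,b,c$ and integer $j$: if $a+b>0$, $\mathcal C_j(a,b,c)=(-1)^{j+1}\prod_{i=1}^{a+b-1}(1-(-q)^i)$; and $\mathcal C_j(0,0,c)=\sum_{l=1}^{c}\frac1{(-q)^l-1}$. Let $M_{n,h}(a,b,c,i,s)=(-q)^{n(h-i)+\frac{(i-s)(2n-i+s+1)}{2}-h^2+s(2n-2c-s)}(-1)^{i+h}\frac{P(n-i)}{P(n-h)P(h)}\cdot\frac{\prod_{l=s+1}^{h}(1-(-q)^{-l})}{P(h-i)P(i-s)}\cdot\frac{P(c)P(b)}{P(c-i+s)P(b-s)}\cdot\mathcal C_{h+1-s}(a,b-s,c+s-i)$. For nonnegative $a,b,c$ with $a+b+c=n$ and $(a,b,c)\ne(0,t,n-t)$ for $t\le h-1$, $D_{n,h}(a,b,c)=\sum_{0\le s\le\min(h,b)}\sum_{s\le i\le\min(s+c,h)}M_{n,h}(a,b,c,i,s)$.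 *)

(* Defs.v *)
From mathcomp Require Import all_boot all_order all_algebra.

Set Implicit Arguments.
Unset Strict Implicit.
Unset Printing Implicit Defensive.

Import Order.TTheory GRing.Theory Num.Theory.
Local Open Scope ring_scope.

Definition odd_prime_power (q : nat) : Prop :=
  exists p k : nat, [/\ prime p, odd p, (0 < k)%N & q = (p ^ k)%N].

Definition mq (q : nat) : rat := - q%:R.

Definition Pq (q k : nat) : rat := \prod_(1 <= l < k.+1) (1 - mq q ^- l).

Definition Cq (q : nat) (j : int) (a b c : nat) : rat :=
  if (0 < a + b)%N then (-1) ^ (j + 1) * \prod_(1 <= i < a + b) (1 - mq q ^+ i)
  else \sum_(1 <= l < c.+1) (mq q ^+ l - 1)^-1.

(* Exponent of -q in [Mq], computed in [int].  The division by 2 is exact: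
   i - s and 2n + 1 - (i - s) have opposite parities. *)
Definition Mexp (n h c i s : nat) : int :=
  n%:Z * (h%:Z - i%:Z)
  + ((i%:Z - s%:Z) * (2 * n%:Z - i%:Z + s%:Z + 1) %/ 2)%Z
  - h%:Z ^+ 2
  + s%:Z * (2 * n%:Z - 2 * c%:Z - s%:Z).

(* For s <= min(h, b), s <= i <= min(s + c, h) and h <= n, the only arguments
   at which [Mq] is used, none of the natural-number subtractions truncates. *)
Definition Mq (q n h a b c i s : nat) : rat :=
  mq q ^ Mexp n h c i s * (-1) ^+ (i + h)
  * (Pq q (n - i) / (Pq q (n - h) * Pq q h))
  * ((\prod_(s.+1 <= l < h.+1) (1 - mq q ^- l))
     / (Pq q (h - i) * Pq q (i - s)))
  * (Pq q c * Pq q b / (Pq q (c + s - i) * Pq q (b - s)))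
  * Cq q (h%:Z + 1 - s%:Z) a (b - s) (c + s - i).

(* Meaningful only for a + b + c = n and (a, b, c) <> (0, t, n - t) for all
   t <= h - 1. *)
Definition Dq (q n h a b c : nat) : rat :=
  \sum_(0 <= s < (minn h b).+1)
    \sum_(s <= i < (minn (s + c) h).+1) Mq q n h a b c i s.

(* Main.v *)
Require Import Defs.
From mathcomp Require Import all_boot all_order all_algebra.
From mathcomp Require Import zify ring.

(* Write x = -q, y = 1/x and m = a + b, and let [n, k]_x and (z; x)_k be the
   Gaussian binomials and q-Pochhammer symbols.  With i = s + k, the factors of
   M_{n,h} that depend on k are (-1)^k y^(k choose 2) [c, k]_y [n-s-k, n-h]_y:
   their sum over k is a c-fold q-difference, y^(c(h-s)) [m-s, m-h]_y.  In
   base x the inner sum of D_{n,h} becomes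
     x^(s(m-h+a)) [m-s, m-h]_x [b, s]_x (x; x)_(m-s-1),
   which for a <= 1 is a constant multiple of [h, s]_x z^s (z; x)_(h-s), where
   z = x^(m-h+a).  By the q-binomial theorem these terms add up to 1 over
   0 <= s <= h.  If a = 1 and h = b + 1 the term s = h is missing, but there
   [m-s, m-h]_x = 1 and the theorem applies with h - 1 in place of h. *)

Set Implicit Arguments.
Unset Strict Implicit.
Unset Printing Implicit Defensive.

Import GRing.Theory Num.Theory.
Local Open Scope ring_scope.

Definition qpoch (R : nzRingType) (z x : R) (k : nat) : R :=
  \prod_(0 <= l < k) (1 - z * x ^+ l).

Fixpoint gbin (R : nzRingType) (x : R) (n k : nat) : R :=
  match n, k with
  | _, 0 => 1
  | 0, _.+1 => 0
  | n'.+1, k'.+1 => gbin x n' k' + x ^+ k'.+1 * gbin x n' k'.+1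
  end.

Definition not_unity_root (R : nzRingType) (x : R) : Prop :=
  forall k : nat, x ^+ k.+1 != 1.

Section RingIdentities.

Variables (R : comNzRingType) (x : R).

Lemma qpoch0 (z : R) : qpoch z x 0 = 1.
Proof. exact: big_nil. Qed.

Lemma qpochS (z : R) (k : nat) :
  qpoch z x k.+1 = qpoch z x k * (1 - z * x ^+ k).
Proof. exact: big_nat_recr. Qed.

Lemma qpochD (z : R) (j k : nat) :
  qpoch z x (j + k) = qpoch z x j * qpoch (z * x ^+ j) x k.
Proof.
elim: k => [|k IHk]; first by rewrite addn0 qpoch0 mulr1.
by rewrite addnS !qpochS IHk exprD !mulrA.
Qed.

Lemma mul_qpoch_prod (m n : nat) : (m <= n)%N ->
  qpoch x x m * \prod_(m.+1 <= l < n.+1) (1 - x ^+ l) = qpoch x x n.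
Proof.
move=> lemn; rewrite /qpoch [RHS](big_cat_nat (n := m)) //=.
by rewrite big_add1; congr (_ * _); apply: eq_bigr => l _; rewrite exprS.
Qed.

Lemma gbin0 (n : nat) : gbin x n 0 = 1.
Proof. by case: n. Qed.

Lemma gbinS (n k : nat) :
  gbin x n.+1 k.+1 = gbin x n k + x ^+ k.+1 * gbin x n k.+1.
Proof. by []. Qed.

Lemma gbin_small (n k : nat) : (n < k)%N -> gbin x n k = 0.
Proof.
elim: n k => [|n IHn] [|k] //; rewrite ltnS => ltnk.
by rewrite gbinS !IHn ?mulr0 ?addr0 // ltnW.
Qed.

Lemma gbinn (n : nat) : gbin x n n = 1.
Proof. by elim: n => // n IHn; rewrite gbinS IHn gbin_small // mulr0 addr0. Qed.

Lemma gbinS_dual (n k : nat) :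
  gbin x n.+1 k.+1 = x ^+ (n - k) * gbin x n k + gbin x n k.+1.
Proof.
elim: n k => [|n IHn] [|k].
- by rewrite /=; ring.
- by rewrite /=; ring.
- by rewrite gbinS {1}IHn !subn0 gbinS !gbin0 (exprS x n); ring.
rewrite gbinS {1}IHn {1}(IHn k.+1) !gbinS subSS.
case: (ltnP k n) => [ltkn|lenk]; last by rewrite (@gbin_small n k.+1) //; ring.
by rewrite -[in x ^+ (n - k)]subnSK // !exprS; ring.
Qed.

Lemma gbin_qpoch (k l : nat) :
  gbin x (k + l) k * (qpoch x x k * qpoch x x l) = qpoch x x (k + l).
Proof.
elim: k l => [|k IHk] l; first by rewrite gbin0 qpoch0 !mul1r.
elim: l => [|l IHl]; first by rewrite addn0 gbinn qpoch0 mulr1 mul1r.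
have -> : qpoch x x (k.+1 + l.+1) =
    (1 - x * x ^+ k) * qpoch x x (k + l.+1)
    + x ^+ k.+1 * (1 - x * x ^+ l) * qpoch x x (k.+1 + l).
  by rewrite addnS addSnnS qpochS addnS !exprS exprD; ring.
by rewrite -IHk -IHl addnS gbinS addSnnS !qpochS; ring.
Qed.

Lemma sum_gbinS (n : nat) (f : nat -> R) :
  \sum_(0 <= k < n.+2) gbin x n.+1 k * f k =
  \sum_(0 <= k < n.+1) gbin x n k * (f k + x ^+ (n - k) * f k.+1).
Proof.
have shift : \sum_(0 <= k < n.+1) gbin x n k * f k =
    f 0%N + \sum_(0 <= k < n.+1) gbin x n k.+1 * f k.+1.
  rewrite big_nat_recl // gbin0 mul1r [in RHS]big_nat_recr //=.
  by rewrite gbin_small // mul0r addr0.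
rewrite big_nat_recl // gbin0 mul1r.
under eq_bigr do rewrite gbinS_dual mulrDl addrC.
rewrite big_split addrA -shift -big_split.
by apply: eq_bigr => k _ /=; ring.
Qed.

Lemma sum_gbin_qpoch (z : R) (n : nat) :
  \sum_(0 <= k < n.+1) gbin x n k * (z ^+ k * qpoch z x (n - k)) = 1.
Proof.
elim: n => [|n IHn]; first by rewrite big_nat1 gbin0 qpoch0 !mul1r.
rewrite sum_gbinS -[RHS]IHn; apply: eq_big_nat => k /andP[_ lekn].
by rewrite subSS subSn // qpochS exprS; ring.
Qed.

(* A coefficient of (z; x)_c / (z; x)_(r+1) = 1 / (z x^c; x)_(r+1-c); the
   recurrence [sum_gbinS] turns it into a q-difference in [n]. *)
Lemma sum_gbin_alternating (c r n : nat) : (c <= r)%N -> (c <= n)%N ->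
  \sum_(0 <= k < c.+1)
     gbin x c k * ((-1) ^+ k * x ^+ 'C(k, 2) * gbin x (n - k) r) =
  x ^+ (c * (n - r)) * gbin x (n - c) (r - c).
Proof.
elim: c n => [|c IHc] n ltcr lecn.
  by rewrite big_nat1 gbin0 bin0n mul0n !subn0 !mul1r.
case: n lecn => // n lecn; rewrite sum_gbinS.
rewrite (eq_big_nat _ _ (F2 := fun k =>
    gbin x c k * ((-1) ^+ k * x ^+ 'C(k, 2) * gbin x (n.+1 - k) r)
    - x ^+ c * (gbin x c k * ((-1) ^+ k * x ^+ 'C(k, 2) * gbin x (n - k) r))));
    last first.
  move=> k /andP[_ lekc]; rewrite subSS binS bin1 exprD (exprS (-1)).
  by rewrite -[in x ^+ c](@subnK k c) // exprD; ring.
rewrite sumrB -mulr_sumr !IHc ?(ltnW ltcr) ?leqW // subSS (@subSn c n) //.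
rewrite -(subnSK ltcr) gbinS_dual.
have -> : (n - c - (r - c.+1) = n.+1 - r)%N by lia.
rewrite mulrDr mulrA -exprD -mulSnr -[RHS]addr0 -addrA; congr (_ + _).
rewrite mulrA -exprD -mulnS -mulrBl.
case: (leqP r n) => [lern|ltnr]; first by rewrite subSn // subrr mul0r.
by rewrite gbin_small ?mulr0 // subnSK // ltn_sub2r // (leq_ltn_trans lecn).
Qed.

Lemma sum_gbin_alternating_minn (c r n : nat) : (c <= r)%N -> (c <= n)%N ->
  \sum_(0 <= k < (minn c (n - r)).+1)
     gbin x c k * ((-1) ^+ k * x ^+ 'C(k, 2) * gbin x (n - k) r) =
  x ^+ (c * (n - r)) * gbin x (n - c) (r - c).
Proof.
move=> lecr lecn; rewrite -sum_gbin_alternating //.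
rewrite [RHS](big_cat_nat (n := (minn c (n - r)).+1)) //=; last first.
  by rewrite ltnS geq_minl.
rewrite [X in _ + X]big_nat [X in _ + X]big1 ?addr0 // => k ltk.
by rewrite (@gbin_small (n - k)) ?mulr0 //; lia.
Qed.

End RingIdentities.

Lemma gbinV (R : comUnitRingType) (x : R) (n k : nat) :
  x \is a GRing.unit -> gbin x^-1 n k = x ^- (k * (n - k)) * gbin x n k.
Proof.
move=> x_unit; elim: n k => [|n IHn] [|k]; rewrite ?gbin0 ?invr1 ?mulr1 //.
  by rewrite !gbin_small ?mulr0.
rewrite gbinS_dual gbinS subSS !IHn mulrDr !mulrA -!exprVn -exprD -mulSn.
congr (_ + _).
case: (ltnP k n) => [ltkn|lenk]; last by rewrite !gbin_small ?mulr0.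
by rewrite -(subnSK ltkn) mulnS addnC exprD (exprVn _ k.+1) divrK ?unitrX.
Qed.

Section FieldIdentities.

Variables (F : fieldType) (x : F).
Hypothesis x_nroot : not_unity_root x.

Lemma subr1X_neq0 (k : nat) : 1 - x ^+ k.+1 != 0.
Proof. by rewrite subr_eq0 eq_sym. Qed.

Lemma qpoch_neq0 (k : nat) : qpoch x x k != 0.
Proof.
elim: k => [|k IHk]; first by rewrite qpoch0 oner_neq0.
by rewrite qpochS mulf_neq0 // -exprS subr1X_neq0.
Qed.

Lemma gbinE (n k : nat) : (k <= n)%N ->
  gbin x n k = qpoch x x n / (qpoch x x k * qpoch x x (n - k)).
Proof.
move=> lekn; rewrite -[in qpoch x x n](subnKC lekn) -gbin_qpoch subnKC //.
by rewrite mulfK // mulf_neq0 // qpoch_neq0.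
Qed.

Lemma prod_qpochE (m n : nat) : (m <= n)%N ->
  \prod_(m.+1 <= l < n.+1) (1 - x ^+ l) = qpoch x x n / qpoch x x m.
Proof.
by move=> lemn; rewrite -(mul_qpoch_prod x lemn) mulrC mulKf ?qpoch_neq0.
Qed.

Lemma mul_gbin_gbin (m h s : nat) : (s <= h)%N -> (h <= m)%N ->
  gbin x (m - s) (m - h) * gbin x m s = gbin x m h * gbin x h s.
Proof.
move=> lesh lehm; rewrite !gbinE; [|lia..].
have -> : (m - s - (m - h) = h - s)%N by lia.
by field; rewrite !qpoch_neq0.
Qed.

Lemma sum_gbin_gbin_qpoch_pred (m h : nat) : (h < m)%N ->
  \sum_(0 <= s < h.+1) x ^+ (s * (m - h)) * gbin x (m - s) (m - h)
     * gbin x m s * qpoch x x (m - s).-1 =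
  \prod_(h.+1 <= l < m.+1) (1 - x ^+ l) / (1 - x ^+ (m - h)).
Proof.
move=> lthm; have lehm := ltnW lthm; pose z := x ^+ (m - h).
have summandE s : (s <= h)%N ->
    x ^+ (s * (m - h)) * gbin x (m - s) (m - h) * gbin x m s
      * qpoch x x (m - s).-1 =
    gbin x m h * qpoch x x (m - h).-1
      * (gbin x h s * (z ^+ s * qpoch z x (h - s))).
  move=> lesh; rewrite -(mulrA (x ^+ _)) mul_gbin_gbin //.
  have -> : ((m - s).-1 = (m - h).-1 + (h - s))%N by lia.
  by rewrite /z qpochD -exprS -(subnSK lthm) mulnC exprM /=; ring.
under [LHS]eq_big_nat => s lesh do rewrite summandE //.
rewrite -mulr_sumr sum_gbin_qpoch mulr1 prod_qpochE // gbinE //.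
rewrite -(subnSK lthm) qpochS -exprS.
by field; rewrite !qpoch_neq0 subr1X_neq0.
Qed.

Lemma sum_gbinS_gbin_qpoch (m h : nat) : (h <= m)%N ->
  \sum_(0 <= s < h.+1) x ^+ (s * (m.+1 - h).+1) * gbin x (m.+1 - s) (m.+1 - h)
     * gbin x m s * qpoch x x (m - s) =
  \prod_(h.+1 <= l < m.+1) (1 - x ^+ l).
Proof.
move=> lehm; pose z := x ^+ (m.+1 - h).+1.
have summandE s : (s <= h)%N ->
    x ^+ (s * (m.+1 - h).+1) * gbin x (m.+1 - s) (m.+1 - h) * gbin x m s
      * qpoch x x (m - s) =
    qpoch x x m / qpoch x x h * (gbin x h s * (z ^+ s * qpoch z x (h - s))).
  move=> lesh; have -> : qpoch z x (h - s) =
      qpoch x x (m.+1 - s) / qpoch x x (m.+1 - h).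
    have -> : (m.+1 - s = m.+1 - h + (h - s))%N by lia.
    by rewrite qpochD -exprS mulrC mulKf // qpoch_neq0.
  rewrite !gbinE //; [|lia..].
  have -> : (m.+1 - s - (m.+1 - h) = h - s)%N by lia.
  by rewrite mulnC exprM -/z; field; rewrite !qpoch_neq0.
under [LHS]eq_big_nat => s lesh do rewrite summandE //.
by rewrite -mulr_sumr sum_gbin_qpoch mulr1 prod_qpochE.
Qed.

Lemma not_unity_rootV : not_unity_root x^-1.
Proof. by move=> k; rewrite exprVn invr_eq1. Qed.

End FieldIdentities.

Lemma MexpE (m h c k s : nat) : (k + s <= h)%N -> (h <= m)%N ->
  Mexp (m + c) h c (k + s) s =
  (h * (m - h) + s * (m - s) + c * (h - s))%N%:Z - ('C(k, 2))%:Z.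
Proof.
have bin2E : (2 * 'C(k, 2) + k = k * k)%N.
  by rewrite -mul_bin_diag bin1; case: k => // k; lia.
move=> /subnKC <-; move: (h - _)%N => u /subnKC <-; move: (m - _)%N => v.
rewrite /Mexp [X in (X %/ 2)%Z](_ : _ =
  ((k + s + u + v + c)%N%:Z * k%:Z - ('C(k, 2))%:Z) * 2); last by lia.
rewrite mulzK // addKn.
have -> : (k + s + u - s = k + u)%N by lia.
have -> : (k + s + u + v - s = k + u + v)%N by lia.
lia.
Qed.

Lemma mq_neq0 (q : nat) : odd_prime_power q -> mq q != 0.
Proof.
case=> p [k [p_prime _ _ ->]].
by rewrite oppr_eq0 pnatr_eq0 expn_eq0 eqn0Ngt prime_gt0.
Qed.

Lemma mq_not_unity_root (q : nat) : odd_prime_power q -> not_unity_root (mq q).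
Proof.
case=> p [k [p_prime _ k_gt0 ->]] l; apply/eqP => /(congr1 Num.norm).
rewrite normrX normrN normr_nat normr1 => /eqP; rewrite -natrX pnatr_eq1.
by rewrite -expnM -(expn0 p) eqn_exp2l ?prime_gt1 // muln_eq0; lia.
Qed.

Section Reduction.

Variable q : nat.
Hypothesis q_pp : odd_prime_power q.

Local Notation x := (mq q).
Local Notation y := (mq q)^-1.

Let x_neq0 : x != 0 := mq_neq0 q_pp.
Let x_nroot : not_unity_root x := mq_not_unity_root q_pp.
Let y_nroot : not_unity_root y := not_unity_rootV x_nroot.

Lemma Pq_qpoch (k : nat) : Pq q k = qpoch y y k.
Proof.
by rewrite /Pq big_add1; apply: eq_bigr => l _; rewrite -exprVn exprS.
Qed.

Lemma Cq_qpoch (j : int) (a b c : nat) : (0 < a + b)%N ->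
  Cq q j a b c = (-1) ^ (j + 1) * qpoch x x (a + b).-1.
Proof.
move=> ab_gt0; rewrite /Cq ab_gt0 -{1}(prednK ab_gt0) big_add1 /=.
by congr (_ * _); apply: eq_bigr => l _; rewrite exprS.
Qed.

Lemma Pq_ratio_gbin (n h b c k s : nat) :
  (h <= n)%N -> (s <= b)%N -> (k <= c)%N -> (k + s <= h)%N ->
  Pq q (n - (k + s)) / (Pq q (n - h) * Pq q h)
  * ((\prod_(s.+1 <= l < h.+1) (1 - x ^- l))
     / (Pq q (h - (k + s)) * Pq q (k + s - s)))
  * (Pq q c * Pq q b / (Pq q (c + s - (k + s)) * Pq q (b - s))) =
  gbin y c k * gbin y (n - s - k) (n - h) * gbin y b s.
Proof.
move=> lehn lesb lekc leksh.
under eq_bigr do rewrite -exprVn.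
have lesh : (s <= h)%N by lia.
rewrite prod_qpochE // !Pq_qpoch !gbinE //; [|lia..].
rewrite addnK subnDr -subnDA (addnC s).
have -> : (n - (k + s) - (n - h) = h - (k + s))%N by lia.
by field; rewrite !qpoch_neq0.
Qed.

Lemma MqE (h a b c k s : nat) :
  (h <= a + b)%N -> (s <= b)%N -> (s < a + b)%N -> (k <= c)%N ->
  (k + s <= h)%N ->
  Mq q (a + b + c) h a b c (k + s) s =
  x ^+ (h * (a + b - h) + s * (a + b - s) + c * (h - s))
  * gbin y b s * qpoch x x (a + b - s).-1
  * (gbin y c k * ((-1) ^+ k * y ^+ 'C(k, 2)
       * gbin y (a + b + c - s - k) (a + b + c - h))).
Proof.
move=> lehm lesb ltsm lekc leksh.
have sign : (-1) ^+ (k + s + h) * (-1) ^ (h%:Z + 1 - s%:Z + 1) =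
    (-1) ^+ k :> rat.
  have -> : h%:Z + 1 - s%:Z + 1 = (h - s).+2%:Z by lia.
  by rewrite -exprnP -exprD -signr_odd -[RHS]signr_odd; congr (_ ^+ _); lia.
rewrite /Mq -2!(mulrA (_ * (-1) ^+ _)) Pq_ratio_gbin //; last by lia.
rewrite Cq_qpoch addnBA // ?subn_gt0 // MexpE // expfzDr // -invr_expz -!exprnP.
by rewrite -sign exprVn; ring.
Qed.

Lemma sum_Mq (h a b c s : nat) :
  (h <= a + b)%N -> (s <= h)%N -> (s <= b)%N -> (s < a + b)%N ->
  \sum_(s <= i < (minn (s + c) h).+1) Mq q (a + b + c) h a b c i s =
  x ^+ (s * (a + b - h + a)) * gbin x (a + b - s) (a + b - h) * gbin x b s
  * qpoch x x (a + b - s).-1.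
Proof.
move=> lehm lesh lesb ltsm.
rewrite -{1}[s]add0n big_addn.
have -> : ((minn (s + c) h).+1 - s = (minn c (h - s)).+1)%N by lia.
under eq_big_nat => k lek do (rewrite MqE //; [|lia..]).
have hsE : (h - s = a + b + c - s - (a + b + c - h))%N by lia.
rewrite -mulr_sumr [in minn _ _]hsE sum_gbin_alternating_minn; [|lia..].
rewrite -hsE !gbinV ?unitfE //.
have -> : (a + b + c - h - c = a + b - h)%N by lia.
have -> : (a + b + c - s - c = a + b - s)%N by lia.
have -> : (a + b - s - (a + b - h) = h - s)%N by lia.
have -> : (h * (a + b - h) + s * (a + b - s) =
    s * (a + b - h + a) + s * (b - s) + (a + b - h) * (h - s))%N by nia.
by rewrite !exprD exprVn; field; rewrite !expf_neq0.
Qed.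

Lemma Dq_sum_gbin (h a b c : nat) : (h <= a + b)%N -> (minn h b < a + b)%N ->
  Dq q (a + b + c) h a b c =
  \sum_(0 <= s < (minn h b).+1)
    x ^+ (s * (a + b - h + a)) * gbin x (a + b - s) (a + b - h) * gbin x b s
    * qpoch x x (a + b - s).-1.
Proof. by move=> lehm ltm; apply: eq_big_nat => s les; apply: sum_Mq; lia. Qed.

Lemma Dq_a0E (h b c : nat) : (h < b)%N ->
  Dq q (b + c) h 0 b c =
  \prod_(h.+1 <= l < b.+1) (1 - x ^+ l) / (1 - x ^+ (b - h)).
Proof.
move=> lthb; rewrite -sum_gbin_gbin_qpoch_pred //.
rewrite (@Dq_sum_gbin h 0 b c); [|lia..].
rewrite add0n (minn_idPl (ltnW lthb)).
by apply: eq_bigr => s _; rewrite addn0.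
Qed.

Lemma Dq_a1E (h b c : nat) : (h <= b)%N ->
  Dq q (b + c).+1 h 1 b c = \prod_(h.+1 <= l < b.+1) (1 - x ^+ l).
Proof.
move=> lehb; rewrite -sum_gbinS_gbin_qpoch //.
rewrite (@Dq_sum_gbin h 1 b c); [|lia..].
rewrite add1n (minn_idPl lehb); apply: eq_big_nat => s lesh.
by rewrite addn1 (@subSn s b) //; lia.
Qed.

Lemma Dq_a1_succ (b c : nat) : Dq q (b + c).+1 b.+1 1 b c = 1.
Proof.
rewrite (@Dq_sum_gbin b.+1 1 b c); [|lia..].
rewrite add1n (minn_idPr (leqnSn b)).
rewrite -[RHS](sum_gbin_qpoch x x b); apply: eq_big_nat => s lesb.
by rewrite subnn add0n muln1 gbin0 mulr1 subSn //=; ring.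
Qed.

End Reduction.

Theorem theorem9p8 (q n h b c : nat) (hq : odd_prime_power q) (hn : (h <= n)%N) :
  ((h + 1 <= b)%N -> (b <= n)%N -> (b + c)%N = n ->
     Dq q n h 0 b c =
       (\prod_(h.+1 <= l < b.+1) (1 - mq q ^+ l)) / (1 - mq q ^+ (b - h)))
  /\
  ((h <= b + 1)%N -> (b <= n)%N -> (b + c + 1)%N = n ->
     ((b + 1)%N = h \/ b = h -> Dq q n h 1 b c = 1)
     /\
     ((h + 1 <= b)%N ->
        Dq q n h 1 b c = \prod_(h.+1 <= l < b.+1) (1 - mq q ^+ l))).
Proof.
rewrite !addn1; split=> [lthb _ <-|_ _ <-]; first exact: Dq_a0E.
split=> [[<-|<-]|/ltnW lehb].
- exact: Dq_a1_succ.
- by rewrite Dq_a1E // big_geq.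
- exact: Dq_a1E.
Qed.
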